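(* Let $n,p\ge 1$, let $0<\mu\le L<\infty$, and let $f_1,\dots,f_n:\mathbb{R}^p\to\mathbb{R}$ be differentiable, $\mu$-strongly convex functions with $L$-Lipschitz continuous gradients. Let $x^*$ be the minimizer of $f=\frac1n\sum_{i=1}^n f_i$, let $\kappa=L/\mu$ and $\rho=(\kappa-1)/(\kappa+1)$. Let $(x^k)_{k\ge 0}$ be the sequence generated by the DIAG method from $x^0\in\mathbb{R}^p$ with stepsize $\epsilon=2/(\mu+L)$. Then for every integer $m>1$, the error after $m$ passes over the set of functions (that is, after $mn$ gradient evaluations, which corresponds to the iterate $x^{k}$ with $k=n(m-1)+1$) satisfies $$\|x^{n(m-1)+1}-x^*\|\le \rho^{m}\left[1-\frac{1-\rho}{n}\times\min\left\{1,\frac{n-1}{2}\right\}\right]\|x^0-x^*\|.$$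
   Context: $\|\cdot\|$ is the Euclidean norm. A differentiable $f_i$ is $\mu$-strongly convex if $(\nabla f_i(x)-\nabla f_i(y))^T(x-y)\ge \mu\|x-y\|^2$ for all $x,y\in\mathbb{R}^p$; its gradient is $L$-Lipschitz if $\|\nabla f_i(x)-\nabla f_i(y)\|\le L\|x-y\|$ for all $x,y\in\mathbb{R}^p$. DIAG (Double Incremental Aggregated Gradient) method with stepsize $\epsilon$: given $x^0\in\mathbb{R}^p$, set $y_1^0=\dots=y_n^0=x^0$. For $k=0,1,2,\dots$, let $i^k=(k \bmod n)+1$, compute $$x^{k+1}=\frac1n\sum_{i=1}^n y_i^k-\frac{\epsilon}{n}\sum_{i=1}^n\nabla f_i(y_i^k),$$ and set $y_{i^k}^{k+1}=x^{k+1}$ and $y_i^{k+1}=y_i^k$ for $i\ne i^k$. Gradient count: computing $x^1$ uses the $n$ gradients $\nabla f_i(x^0)$, and each later iterate needs one new gradient evaluation (all others being stored), so computing $x^k$ uses $n+k-1$ gradient evaluations. *)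

(* Defs.v *)
From mathcomp Require Import all_boot all_order all_algebra.
From mathcomp Require Import boolp classical_sets reals topology normedtype.
From mathcomp Require Import derive.

Set Implicit Arguments.
Unset Strict Implicit.
Unset Printing Implicit Defensive.

Import Order.TTheory GRing.Theory Num.Theory.
Import numFieldNormedType.Exports.

Local Open Scope ring_scope.

Definition dotv (R : realType) (p : nat) (u v : 'rV[R]_p) : R :=
  \sum_(j < p) u 0 j * v 0 j.

(* The library norm [`|x|] on ['rV[R]_p] is the sup norm, hence a separate
   Euclidean norm.  Differentiability below uses the library norm, which is
   harmless: all norms on R^p are equivalent. *)
Definition enorm (R : realType) (p : nat) (u : 'rV[R]_p) : R :=
  Num.sqrt (dotv u u).

Definition gradient (R : realType) (p : nat) (f : 'rV[R]_p -> R)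
    (x : 'rV[R]_p) : 'rV[R]_p :=
  \row_(j < p) 'D_(delta_mx 0 j) f x.

(* Meant for functions that are differentiable everywhere. *)
Definition strongly_convex (R : realType) (p : nat) (mu : R)
    (f : 'rV[R]_p -> R) : Prop :=
  forall x y : 'rV[R]_p,
    mu * enorm (x - y) ^+ 2 <= dotv (gradient f x - gradient f y) (x - y).

Definition lipschitz_gradient (R : realType) (p : nat) (L : R)
    (f : 'rV[R]_p -> R) : Prop :=
  forall x y : 'rV[R]_p,
    enorm (gradient f x - gradient f y) <= L * enorm (x - y).

Definition average (R : realType) (n p : nat) (f : 'I_n -> 'rV[R]_p -> R)
    (x : 'rV[R]_p) : R :=
  n%:R^-1 * \sum_(i < n) f i x.

Definition is_minimizer (R : realType) (p : nat) (f : 'rV[R]_p -> R)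
    (z : 'rV[R]_p) : Prop :=
  forall x : 'rV[R]_p, f z <= f x.

Definition diag_update (R : realType) (n p : nat)
    (f : 'I_n -> 'rV[R]_p -> R) (eps : R) (y : 'I_n -> 'rV[R]_p) : 'rV[R]_p :=
  n%:R^-1 *: \sum_(i < n) y i
  - (eps / n%:R) *: \sum_(i < n) gradient (f i) (y i).

(* [diag_y f eps x0 k i] is y_i^k.  Functions are indexed from 0 to n - 1, so
   the function visited at step k is [k %% n] rather than [k %% n + 1]. *)
Fixpoint diag_y (R : realType) (n p : nat) (f : 'I_n -> 'rV[R]_p -> R)
    (eps : R) (x0 : 'rV[R]_p) (k : nat) : 'I_n -> 'rV[R]_p :=
  if k is k'.+1 then
    fun i => if (i == k' %% n :> nat)%N
             then diag_update f eps (diag_y f eps x0 k')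
             else diag_y f eps x0 k' i
  else fun=> x0.

Definition diag_x (R : realType) (n p : nat) (f : 'I_n -> 'rV[R]_p -> R)
    (eps : R) (x0 : 'rV[R]_p) (k : nat) : 'rV[R]_p :=
  if k is k'.+1 then diag_update f eps (diag_y f eps x0 k') else x0.

(* Number of gradient evaluations used to compute the k-th iterate: all n
   gradients at the starting point for the first one, then a single new
   gradient per iterate, the others being stored. *)
Fixpoint grad_evals (n k : nat) : nat :=
  match k with
  | 0 => 0
  | 1 => n
  | k'.+1 => (grad_evals n k').+1
  end.

(* Main.v *)
(** With [eps = 2 / (mu + L)] each map [x |-> x - eps *: gradient (f i) x] is a
    [rho]-contraction, so each iterate has error at most [rho] times the average
    error of the stored points. During the first pass, iterate [j + 1] thus has
    error at most [rho (1 - j (1 - rho) / n)] times the initial one; averaging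
    these bounds yields the factor [(n - 1) / 2] for iterate [n + 1], while every
    other stored point already carries the factor [1 - (1 - rho) / n]. From then
    on each pass gains a factor [rho]. *)
Require Import Defs.
From mathcomp Require Import all_boot all_order all_algebra.
From mathcomp Require Import boolp classical_sets reals topology normedtype.
From mathcomp Require Import derive.
From mathcomp Require Import ring lra.

Set Implicit Arguments.
Unset Strict Implicit.
Unset Printing Implicit Defensive.

Import Order.TTheory GRing.Theory Num.Theory.
Import numFieldNormedType.Exports.

Local Open Scope ring_scope.

(** * Euclidean inner product and norm *)

Section Dot.
Variables (R : realType) (p : nat).
Implicit Types u v w : 'rV[R]_p.

Lemma dotvC u v : dotv u v = dotv v u.
Proof. by apply: eq_bigr => j _; rewrite mulrC. Qed.

Lemma dotvDl u v w : dotv (u + v) w = dotv u w + dotv v w.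
Proof. by rewrite -big_split; apply: eq_bigr => j _; rewrite mxE mulrDl. Qed.

Lemma dotvZl a u v : dotv (a *: u) v = a * dotv u v.
Proof. by rewrite /dotv mulr_sumr; apply: eq_bigr => j _; rewrite mxE mulrA. Qed.

Lemma dotvDr u v w : dotv u (v + w) = dotv u v + dotv u w.
Proof. by rewrite dotvC dotvDl !(dotvC u). Qed.

Lemma dotvZr a u v : dotv u (a *: v) = a * dotv u v.
Proof. by rewrite dotvC dotvZl dotvC. Qed.

Lemma dotvNl u v : dotv (- u) v = - dotv u v.
Proof. by rewrite -scaleN1r dotvZl mulN1r. Qed.

Lemma dotvNr u v : dotv u (- v) = - dotv u v.
Proof. by rewrite dotvC dotvNl dotvC. Qed.

Definition dotvE := (dotvDl, dotvDr, dotvNl, dotvNr, dotvZl, dotvZr).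

Lemma dotv_suml (I : finType) (F : I -> 'rV[R]_p) v :
  dotv (\sum_i F i) v = \sum_i dotv (F i) v.
Proof.
elim/big_rec2: _ => [|i s t _ <-]; last by rewrite dotvDl.
by rewrite -(scale0r v) dotvZl mul0r.
Qed.

Lemma dotv_ge0 u : 0 <= dotv u u.
Proof. by apply: sumr_ge0 => j _; rewrite -expr2 sqr_ge0. Qed.

Lemma dotv_eq0 u : dotv u u = 0 -> u = 0.
Proof.
move=> /eqP; rewrite psumr_eq0 => [/allP h|j _]; last by rewrite -expr2 sqr_ge0.
apply/rowP => j; rewrite mxE.
by have := h j (mem_index_enum _); rewrite -expr2 sqrf_eq0 => /eqP.
Qed.

Lemma enorm_ge0 u : 0 <= enorm u. Proof. exact: sqrtr_ge0. Qed.

Lemma sqr_enorm u : enorm u ^+ 2 = dotv u u.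
Proof. by rewrite sqr_sqrtr ?dotv_ge0. Qed.

(** Cauchy-Schwarz: the squared norm of [dotv v v *: u - dotv u v *: v] is nonnegative and equals
    [dotv v v] times the gap between the squared sides. *)
Lemma dotv_le_enorm u v : dotv u v <= enorm u * enorm v.
Proof.
apply: (le_trans (ler_norm _)).
rewrite -(@ler_pXn2r _ 2) ?nnegrE ?mulr_ge0 ?enorm_ge0 //.
rewrite exprMn !sqr_enorm real_normK ?num_real //.
have := dotv_ge0 v; rewrite le_eqVlt => /predU1P[/esym v0|v0].
  by rewrite (dotv_eq0 v0) -(scale0r v) !dotvE !mul0r mulr0 expr0n.
have := dotv_ge0 (dotv v v *: u - dotv u v *: v).
rewrite !dotvE (dotvC v u) => h.
rewrite -subr_ge0 -(pmulr_rge0 _ v0).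
by apply: le_trans h _; rewrite le_eqVlt; apply/orP; left; apply/eqP; ring.
Qed.

Lemma enormD u v : enorm (u + v) <= enorm u + enorm v.
Proof.
rewrite -(@ler_pXn2r _ 2) ?nnegrE ?addr_ge0 ?enorm_ge0 //.
rewrite sqrrD !sqr_enorm !dotvE (dotvC v u).
have := dotv_le_enorm u v; lra.
Qed.

Lemma enormZ a u : enorm (a *: u) = `|a| * enorm u.
Proof. by rewrite /enorm !dotvE mulrA -expr2 sqrtrM ?sqr_ge0 // sqrtr_sqr. Qed.

Lemma enorm_sum (I : finType) (F : I -> 'rV[R]_p) :
  enorm (\sum_i F i) <= \sum_i enorm (F i).
Proof.
elim/big_rec2: _ => [|i s t _ h].
  by rewrite /enorm -(scale0r (0 : 'rV[R]_p)) dotvZl mul0r sqrtr0.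
by apply: le_trans (enormD _ _) _; rewrite lerD2l.
Qed.

End Dot.

(** * Quadratic bounds and contraction of the gradient step *)

Section Smooth.
Variables (R : realType) (p : nat) (f : 'rV[R]_p -> R) (mu L : R).
Hypothesis df : forall x, differentiable f x.

Lemma derive_gradient x v : 'D_v f x = dotv (gradient f x) v.
Proof.
rewrite deriveE // {1}(row_sum_delta v) linear_sum /=.
by apply: eq_bigr => j _; rewrite linearZ /= mxE deriveE // mulrC.
Qed.

Lemma is_derive_line x v (t : R) :
  is_derive t 1 (fun s : R => f (x + s *: v)) (dotv (gradient f (x + t *: v)) v).
Proof.
(* The difference quotient at [t] along the line is that of [f] at [x + t *: v] in direction [v]. *)
have E : (fun h : R => h^-1 *: (((fun s : R => f (x + s *: v)) \o shift t) (h *: 1)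
      - f (x + t *: v))) =
    (fun h => h^-1 *: ((f \o shift (x + t *: v)) (h *: v) - f (x + t *: v))).
  apply: funext => h /=; congr (_ *: (f _ - _)).
  by rewrite scalerDl [h *: 1]mulr1 addrCA.
apply: DeriveDef; rewrite /derivable /derive E.
  exact: diff_derivable.
by rewrite -derive_gradient.
Qed.

(** The mean value theorem on [[0, 1]] for [f] along the segment minus a quadratic in the parameter.
    Taking [c] to be [mu] or [L] fixes the sign of the right-hand side, which yields the lower and
    upper quadratic bounds below. *)
Lemma quadratic_mean_value x v c : exists2 t, 0 < t < 1 &
  f (x + v) - f x - dotv (gradient f x) v - c / 2 * dotv v v =
  dotv (gradient f (x + t *: v) - gradient f x) v - c * t * dotv v v.
Proof.
pose q (s : R) := s * dotv (gradient f x) v + s ^+ 2 * (c / 2 * dotv v v).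
pose g (s : R) := f (x + s *: v) - q s.
pose dg (s : R) := dotv (gradient f (x + s *: v)) v
  - (dotv (gradient f x) v + c * s * dotv v v).
have dgP (s : R) : is_derive s 1 g (dg s).
  apply: is_deriveB; first exact: is_derive_line.
  apply: is_derive_eq.
  by rewrite !scaler0 !add0r /GRing.scale /=; field.
have [t] : exists2 t, t \in `]0, 1[%R & g 1 - g 0 = dg t * (1 - 0).
  apply: MVT => //.
  apply: continuous_subspaceT => t.
  exact/differentiable_continuous/derivable1_diffP.
rewrite in_itv /= => t01; rewrite /g /q /dg subr0 mulr1 => E.
exists t => //; rewrite !dotvE; move: E.
rewrite scale1r scale0r addr0 expr1n expr0n /= !mul0r !mul1r; lra.
Qed.

Hypothesis mu_le_L : mu <= L.
Hypothesis sc : strongly_convex mu f.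
Hypothesis lg : lipschitz_gradient L f.

Lemma strongly_convex_ge x v :
  f x + dotv (gradient f x) v + mu / 2 * dotv v v <= f (x + v).
Proof.
have [t /andP[t0 t1] E] := quadratic_mean_value x v mu.
have := sc (x + t *: v) x; rewrite sqr_enorm addrAC subrr add0r.
rewrite dotvZl !dotvZr mulrCA ler_pM2l // => h; lra.
Qed.

Lemma lipschitz_gradient_le x v :
  f (x + v) <= f x + dotv (gradient f x) v + L / 2 * dotv v v.
Proof.
have [t /andP[t0 t1] E] := quadratic_mean_value x v L.
have := lg (x + t *: v) x; rewrite addrAC subrr add0r enormZ gtr0_norm // => h.
have := dotv_le_enorm (gradient f (x + t *: v) - gradient f x) v.
have := ler_wpM2r (enorm_ge0 v) h.
have -> : L * (t * enorm v) * enorm v = L * t * enorm v ^+ 2 by ring.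
rewrite sqr_enorm; lra.
Qed.

(* Baillon-Haddad for the convex function [f - mu/2 |.|^2], whose gradient
   difference is [G] and which is [(L - mu)]-smooth: compare its two bounds at
   the gradient-descent point [x - t G], then optimize over [t]. *)
Lemma cocoercive x y (G := gradient f x - gradient f y - mu *: (x - y)) :
  dotv G G <= (L - mu) * dotv G (x - y).
Proof.
have defG : G = gradient f x - gradient f y - mu *: (x - y) by [].
clearbody G.
have step t : 2 * t * dotv G G - (L - mu) * t ^+ 2 * dotv G G <= dotv G (x - y).
  (* The point [y + t *: G] is treated symmetrically to [x - t *: G]; adding the four bounds cancels
     all values of [f]. *)
  have := lipschitz_gradient_le x (- (t *: G)).
  have := lipschitz_gradient_le y (t *: G).
  have := strongly_convex_ge y (x - y - t *: G).
  have := strongly_convex_ge x (y - x + t *: G).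
  have -> : x + (y - x + t *: G) = y + t *: G by rewrite addrA subrKC.
  have -> : y + (x - y - t *: G) = x - t *: G by rewrite addrA subrKC.
  have EG : dotv G G = dotv (gradient f x) G - dotv (gradient f y) G
     - mu * (dotv x G - dotv y G) by rewrite {1}defG !dotvE.
  have Ed : dotv G (x - y) = dotv (gradient f x) x - dotv (gradient f x) y
     - (dotv (gradient f y) x - dotv (gradient f y) y)
     - mu * (dotv x x - dotv x y - (dotv x y - dotv y y)).
    by rewrite defG !dotvE (dotvC y x); ring.
  rewrite Ed !dotvE (dotvC y x) (dotvC G x) (dotvC G y).
  have := congr1 ( *%R t) EG.
  clear; lra.
have := dotv_ge0 G; rewrite le_eqVlt => /predU1P[/esym G0|G0].
  by rewrite G0 (dotv_eq0 G0) -(scale0r G) dotvZl mul0r mulr0.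
have := mu_le_L; rewrite -subr_ge0 le_eqVlt => /predU1P[M0|M0].
  (* If [L = mu], the quadratic term in [t] vanishes: [t = 1] forces [dotv G (x - y)] to be positive
     and the second choice forces it to be nonpositive, contradicting [G0]. *)
  have := step 1; have := step (dotv G (x - y) / dotv G G).
  rewrite -M0 !mul0r !subr0 -!mulrA mulVf ?gt_eqF //; lra.
(* [t = 1 / (L - mu)] maximizes the left-hand side of [step]. *)
have := ler_wpM2l (ltW M0) (step (L - mu)^-1).
apply: le_trans; rewrite le_eqVlt; apply/orP; left; apply/eqP.
by field; rewrite gt_eqF.
Qed.

(** With this stepsize the difference of the two steps is [rho *: (x - y) - s *: G], where
    [rho = (L - mu) / (L + mu)] and [s = 2 / (L + mu)]. Since [2 * rho * s = s ^+ 2 * (L - mu)], the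
    gap between the squared sides is exactly [s ^+ 2] times the gap in [cocoercive]. *)
Lemma gradient_step_contraction x y : 0 < mu ->
  enorm ((x - (2 / (mu + L)) *: gradient f x)
         - (y - (2 / (mu + L)) *: gradient f y))
  <= (L - mu) / (L + mu) * enorm (x - y).
Proof.
move=> mu0; have s0 : 0 < L + mu by move: mu_le_L; lra.
have r0 : 0 <= (L - mu) / (L + mu) by apply: divr_ge0; [rewrite subr_ge0 | exact: ltW].
rewrite -(@ler_pXn2r _ 2) ?nnegrE ?(mulr_ge0 r0) ?enorm_ge0 //.
rewrite exprMn !sqr_enorm.
pose G := gradient f x - gradient f y - mu *: (x - y).
have h : dotv G G <= (L - mu) * dotv G (x - y) := cocoercive x y.
have -> : (x - (2 / (mu + L)) *: gradient f x)
    - (y - (2 / (mu + L)) *: gradient f y)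
    = ((L - mu) / (L + mu)) *: (x - y) - (2 / (L + mu)) *: G.
  by apply/rowP => j; rewrite /G (addrC mu) !mxE; field; rewrite gt_eqF.
clearbody G; move: h; set D := x - y; clearbody D; rewrite -subr_ge0 !dotvE (dotvC D).
move: (dotv D D) (dotv G D) (dotv G G) => d c g h.
rewrite [leRHS](_ : _ = (2 / (L + mu)) ^+ 2 * ((L - mu) * c - g)); last first.
  by field; rewrite gt_eqF.
by rewrite mulr_ge0 ?sqr_ge0 ?subr_ge0.
Qed.

End Smooth.

(** A step of [- (n L)^-1 *: S] from [z], with [S] the gradient sum, lowers the sum of the [f i] by
    at least [dotv S S / (2 n L)], so minimality forces [S = 0]. *)
Lemma sum_gradient_minimizer (R : realType) (n p : nat) (L : R)
    (f : 'I_n -> 'rV[R]_p -> R) (z : 'rV[R]_p) :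
  (0 < n)%N -> 0 < L ->
  (forall i x, differentiable (f i) x) ->
  (forall i, lipschitz_gradient L (f i)) ->
  is_minimizer (average f) z -> \sum_i gradient (f i) z = 0.
Proof.
move=> n0 L0 df lg mz; set S := \sum_i _.
have nL0 : 0 < n%:R * L by rewrite mulr_gt0 // ltr0n.
apply: dotv_eq0; apply/eqP; rewrite eq_le dotv_ge0 andbT.
pose v := - (n%:R * L)^-1 *: S.
have mv : \sum_i f i z <= \sum_i f i (z + v).
  by have := mz (z + v); rewrite ler_pM2l // invr_gt0 ltr0n.
have : \sum_i f i (z + v) <=
    \sum_i (f i z + dotv (gradient (f i) z) v + L / 2 * dotv v v).
  by apply: ler_sum => i _; apply: lipschitz_gradient_le.
rewrite !big_split /= -dotv_suml -/S sumr_const card_ord => /(le_trans mv).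
rewrite -addrA lerDl -[X in _ + X]mulr_natl /v !dotvE.
rewrite [leRHS](_ : _ = - ((n%:R * L)^-1 / 2 * dotv S S)).
  by rewrite oppr_ge0 pmulr_rle0 // divr_gt0 ?invr_gt0.
by field; rewrite !gt_eqF ?ltr0n.
Qed.

Lemma triangular (R : realType) k :
  \sum_(j < k) j%:R = k%:R * (k%:R - 1) / 2 :> R.
Proof.
elim: k => [|k IH]; first by rewrite big_ord0 !mul0r.
by rewrite big_ord_recr /= IH -natr1; field.
Qed.

(** * Scalar recursion: cyclic replacement of one error by at most [rho] times the mean *)

Section CyclicAveraging.
Variables (R : realType) (n' : nat) (rho E : R).
Local Notation n := n'.+1.
Variable Y : nat -> 'I_n -> R.
Hypotheses (rho_ge0 : 0 <= rho) (rho_le1 : rho <= 1) (E_ge0 : 0 <= E).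
Hypothesis Y0 : forall i, Y 0 i = E.
Hypothesis Y_visited : forall k (i : 'I_n), i = (k %% n)%N :> nat ->
  Y k.+1 i <= rho / n%:R * \sum_j Y k j.
Hypothesis Y_other : forall k (i : 'I_n), (i : nat) <> (k %% n)%N :> nat -> Y k.+1 i = Y k i.

Lemma visited_le k (i : 'I_n) B : i = (k %% n)%N :> nat -> (forall j, Y k j <= B) ->
  Y k.+1 i <= rho * B.
Proof.
move=> ik YB; apply: le_trans (Y_visited ik) _.
rewrite -mulrA ler_wpM2l // ler_pdivrMl ?ltr0n //.
apply: le_trans (ler_sum _ (fun j _ => YB j)) _.
by rewrite sumr_const card_ord mulr_natl.
Qed.

Lemma first_pass k : (k <= n)%N -> forall i : 'I_n,
  Y k i <= (if (i < k)%N then rho * (1 - i%:R * ((1 - rho) / n%:R)) else 1) * E.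
Proof.
elim: k => [|k IH] kn i; first by rewrite Y0 mul1r.
have {}IH := IH (ltnW kn).
have kk : k = (k %% n)%N by rewrite modn_small.
have [ik|ik] := eqVneq (i : nat) k; last first.
  rewrite Y_other -?kk; last exact/eqP.
  by rewrite ltnS leq_eqVlt (negbTE ik).
rewrite ik ltnSn.
apply: le_trans (Y_visited (etrans ik kk)) _.
rewrite -!mulrA ler_wpM2l //.
(* The refined bounds on visited entries are relaxed to [rho * E], so that the mean depends only on
   their number [k]. *)
have le_rho (j : 'I_n) : Y k j <= (1 - (1 - rho) * (j < k)%:R) * E.
  apply: le_trans (IH j) _; rewrite ler_wpM2r //.
  case: (j < k)%N; rewrite ?mulr1 ?mulr0 ?subr0 ?subKr //.
  rewrite ler_piMr // gerBl mulr_ge0 ?ler0n //.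
  by rewrite divr_ge0 ?subr_ge0 ?ler0n.
apply: le_trans (ler_wpM2l _ (ler_sum _ (fun j _ => le_rho j))) _.
  by rewrite invr_ge0 ler0n.
have visited : \sum_(j < n) (j < k)%:R = k%:R :> R.
  rewrite -natr_sum; congr (_%:R); transitivity (\sum_(j < k) 1)%N; last first.
    by rewrite sum_nat_const card_ord muln1.
  by rewrite (big_ord_widen n (fun=> 1%N) (ltnW kn)) [in RHS]big_mkcond;
  apply: eq_bigr => j _; case: ifP.
rewrite -mulr_suml sumrB -mulr_sumr visited sumr_const card_ord.
rewrite mulrA ler_wpM2r // le_eqVlt; apply/orP; left; apply/eqP.
by field; rewrite addrC natr1 pnatr_eq0.
Qed.

Section LaterPasses.
Variable B : R.
Hypothesis B_ge0 : 0 <= B.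

Lemma pass_step m r : (r < n)%N ->
  (forall i : 'I_n, Y (n * m + r) i <= if (i < r)%N then rho * B else B) ->
  forall i : 'I_n, Y (n * m + r).+1 i <= if (i < r.+1)%N then rho * B else B.
Proof.
move=> rn IH i; have rr : ((n * m + r) %% n)%N = r by rewrite mulnC modnMDl modn_small.
have [ir|ir] := eqVneq (i : nat) r; last first.
  rewrite Y_other ?rr; last exact/eqP.
  by rewrite ltnS leq_eqVlt (negbTE ir).
rewrite ir ltnSn; apply: visited_le => [|j]; first by rewrite rr.
by apply: le_trans (IH j) _; case: ifP => // _; rewrite ler_piMl.
Qed.

(** The hypothesis is taken one step into the pass because at time [n] entry 0 is only known to be
    at most [rho * E], without the extra factor [c] of [passes]; its update at time [n + 1] repairs
    this. *)
Lemma full_pass m :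
  (forall i : 'I_n, Y (n * m + 1) i <= if i == 0 :> nat then rho * B else B) ->
  forall i : 'I_n, Y (n * m.+1) i <= rho * B.
Proof.
move=> h; suff H r : (r < n)%N -> forall i : 'I_n,
    Y (n * m + r.+1) i <= if (i < r.+1)%N then rho * B else B.
  by move=> i; have := H n' (ltnSn _) i; rewrite ltn_ord -mulnSr.
elim: r => [|r IH] rn; first by move=> i; have := h i; rewrite ltnS leqn0.
by rewrite addnS; apply: pass_step => //; apply: IH; apply: ltnW.
Qed.

End LaterPasses.

Lemma passes m :
  Y (n * m.+1 + 1) ord0 <=
  rho ^+ m.+2 * (1 - (1 - rho) / n%:R * Num.min 1 ((n%:R - 1) / 2)) * E.
Proof.
set c := 1 - _.
pose t := (1 - rho) / n%:R.
have t_ge0 : 0 <= t by rewrite divr_ge0 ?subr_ge0 ?ler0n.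
have t_le1 : t <= 1.
  by rewrite ler_pdivrMr ?ltr0n // mul1r (@le_trans _ _ 1) ?ler1n // gerBl.
have c_ge1 : 1 - t <= c by rewrite lerD2l lerN2 ler_piMr // ge_min lexx.
have c_ge2 : 1 - t * ((n%:R - 1) / 2) <= c.
  by rewrite lerD2l lerN2 ler_wpM2l // ge_min lexx orbT.
have c_ge0 : 0 <= c by apply: le_trans c_ge1; rewrite subr_ge0.
(* The invariant covers all entries one step after each pass, the form that [full_pass] consumes. *)
suff H : forall i : 'I_n, Y (n * m.+1 + 1) i <=
    if i == 0 :> nat then rho * (rho ^+ m.+1 * c * E) else rho ^+ m.+1 * c * E.
  by have := H ord0; rewrite eqxx !mulrA -exprS.
have first_index k (i : 'I_n) : (i : nat) = 0%N -> i = (n * k %% n)%N :> nat.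
  by rewrite mulnC modnMl.
elim: m => [|m IH] i; last first.
  have B0 : 0 <= rho ^+ m.+1 * c * E by rewrite !mulr_ge0 ?exprn_ge0.
  have full := full_pass B0 IH.
  rewrite exprS -!mulrA !(mulrA (rho ^+ _)) addn1; case: eqP => [i0|i0].
    by apply: visited_le; [exact: first_index | exact: full].
  by rewrite Y_other // mulnC modnMl.
rewrite muln1 addn1 expr1.
case: eqP => [i0|i0].
  (* Entry 0 averages all the first-pass bounds, and the sum of the indices produces
     [(n - 1) / 2]. *)
  apply: le_trans (Y_visited _) _; first by rewrite modnn.
  apply: le_trans (ler_wpM2l _ (ler_sum _ (fun j _ => first_pass (leqnn n) j))) _.
    by rewrite divr_ge0 ?ler0n.
  under eq_bigr do rewrite ltn_ord.
  rewrite -mulr_suml -mulr_sumr sumrB -mulr_suml sumr_const card_ord triangular.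
  rewrite -!mulrA ler_wpM2l // mulrCA ler_wpM2l // [leLHS]mulrA ler_wpM2r //.
  apply: le_trans c_ge2; rewrite le_eqVlt; apply/orP; left; apply/eqP.
  by rewrite /t; field; rewrite addrC natr1 pnatr_eq0.
(* Here [i >= 1], so the first-pass factor [1 - i * t] is at most [1 - t]. *)
rewrite Y_other ?modnn //.
apply: le_trans (first_pass (leqnn n) _) _; rewrite ltn_ord ler_wpM2r // ler_wpM2l //.
apply: le_trans c_ge1; rewrite lerD2l lerN2 ler_peMl // ler1n lt0n.
exact/eqP.
Qed.

End CyclicAveraging.

(** * Errors of the DIAG iterates *)

Lemma diag_y_visited (R : realType) (n p : nat) (f : 'I_n -> 'rV[R]_p -> R)
    (eps : R) (x0 : 'rV[R]_p) k (i : 'I_n) : i = (k %% n)%N :> nat ->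
  diag_y f eps x0 k.+1 i = diag_x f eps x0 k.+1.
Proof. by move=> /= ->; rewrite eqxx. Qed.

Lemma diag_x_error (R : realType) (n p : nat) (f : 'I_n -> 'rV[R]_p -> R)
    (eps rho : R) (x0 z : 'rV[R]_p) k :
  (0 < n)%N -> \sum_i gradient (f i) z = 0 ->
  (forall i x, enorm ((x - eps *: gradient (f i) x) - (z - eps *: gradient (f i) z))
     <= rho * enorm (x - z)) ->
  enorm (diag_x f eps x0 k.+1 - z) <=
    rho / n%:R * \sum_i enorm (diag_y f eps x0 k i - z).
Proof.
move=> n0 Sz contr; set y := diag_y f eps x0 k.
(* As the gradients at [z] sum to zero, [z] is the mean of its own gradient steps, so the error is a
   mean of differences to which [contr] applies termwise. *)
have -> : diag_x f eps x0 k.+1 - z = n%:R^-1 *: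
    \sum_i ((y i - eps *: gradient (f i) (y i)) - (z - eps *: gradient (f i) z)).
  rewrite /= /diag_update -/y !sumrB -!scaler_sumr Sz scaler0 subr0.
  rewrite sumr_const card_ord -[z *+ n]scaler_nat !scalerBr !scalerA mulVf ?pnatr_eq0 -?lt0n //.
  by rewrite scale1r [eps / _]mulrC.
rewrite enormZ ger0_norm ?invr_ge0 ?ler0n // [rho / _]mulrC -mulrA.
rewrite ler_wpM2l ?invr_ge0 ?ler0n //; apply: le_trans (enorm_sum _) _.
by rewrite mulr_sumr; apply: ler_sum => i _; apply: contr.
Qed.

Theorem corollary3 (R : realType) (n p : nat) (mu L : R)
    (f : 'I_n -> 'rV[R]_p -> R) (x0 xstar : 'rV[R]_p) :
  (1 <= n)%N -> (1 <= p)%N ->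
  0 < mu -> mu <= L ->
  (forall i (x : 'rV[R]_p), differentiable (f i) x) ->
  (forall i, strongly_convex mu (f i)) ->
  (forall i, lipschitz_gradient L (f i)) ->
  is_minimizer (average f) xstar ->
  let kappa := L / mu in
  let rho := (kappa - 1) / (kappa + 1) in
  let x := diag_x f (2 / (mu + L)) x0 in
  forall m : nat, (1 < m)%N ->
  let k := (n * (m - 1) + 1)%N in
  grad_evals n k = (m * n)%N /\
  enorm (x k - xstar) <=
    rho ^+ m * (1 - (1 - rho) / n%:R * Num.min 1 ((n%:R - 1) / 2))
    * enorm (x0 - xstar).
Proof.
case: n f => [//|n'] f _ _ mu0 muL df sc lg mz kappa rho x [//|[//|m]] _ k.
have L0 : 0 < L by apply: lt_le_trans muL.
rewrite /k subn1 -pred_Sn; split.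
  have gE j : grad_evals n'.+1 j.+1 = (n'.+1 + j)%N.
    by elim: j => [|j IH]; rewrite ?addn0 // addnS -IH.
  by rewrite addn1 gE [RHS]mulSn mulnC.
have rhoE : rho = (L - mu) / (L + mu).
  by rewrite /rho /kappa; field; rewrite !gt_eqF // addr_gt0.
have Sz := sum_gradient_minimizer (ltn0Sn n') L0 df lg mz.
pose Y k i := enorm (diag_y f (2 / (mu + L)) x0 k i - xstar).
(* The index of this iterate is 1 modulo [n], so the iterate has just been stored in slot 0. *)
have <- : Y (n'.+1 * m.+1 + 1)%N ord0 = enorm (x (n'.+1 * m.+1 + 1)%N - xstar).
  by rewrite /Y addn1 diag_y_visited // mulnC modnMl.
apply: passes => //.
- by rewrite rhoE divr_ge0 ?subr_ge0 // ltW // addr_gt0.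
- by rewrite rhoE ler_pdivrMr ?addr_gt0 // mul1r; lra.
- exact: enorm_ge0.
- move=> j i ij; rewrite /Y diag_y_visited //; apply: diag_x_error => // l u.
  by rewrite rhoE; apply: gradient_step_contraction.
- by move=> j i /eqP ij; rewrite /Y /= (negbTE ij).
Qed.
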